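(* Let $\epsilon>0$ be given. Suppose that $\{a_n\}_{n=1}^\infty$ is a positive real sequence such that only finitely many elements are lower than $1+\epsilon$. For each $m\in\mathbb{N}$, define $\Phi_m:\mathbb{R}\to\mathbb{R}$ by $\Phi_m = \phi_{a_m}\circ\phi_{a_{m-1}}\circ\cdots\circ\phi_{a_1}$. Then for any $x\in\mathbb{R}\setminus\{0\}$, $$\lim_{m\to\infty}\left|\Phi_m(x)\right|\ \geq\ \xi_{1+\epsilon}.$$
   Context: For $a>0$, the function $\phi_a:\mathbb{R}\to\mathbb{R}$ is defined by $\phi_a(x)=\tanh(ax)$. For $a>1$, $\phi_a$ has exactly three distinct fixed points $-\xi_a$, $0$, $\xi_a$ with $\xi_a>0$; thus $\xi_a$ denotes the unique positive real number with $\tanh(a\,\xi_a)=\xi_a$.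
   Formalization: The limit of |Φ_m(x)| need not exist (e.g. a_n alternating between 2 and 3), so the limit is replaced by the lower limit, which equals the limit whenever the limit exists. *)

(* Defs.v *)
From Stdlib Require Import Reals Lra Lia ClassicalEpsilon Finite_sets.
From Coquelicot Require Import Coquelicot.
Open Scope R_scope.

Definition phi (a x : R) : R := tanh (a * x).

Definition is_xi (a x : R) : Prop := 0 < x /\ phi a x = x.

(* Meaningful only for [1 < a]: see [xi_exists_unique] and [xi_spec]. *)
Definition xi (a : R) : R := epsilon (inhabits 0) (is_xi a).

(* The sequence is indexed from 1: [Phi a m] is phi_(a_m) o ... o phi_(a_1),
   and the value [a 0] is never used. *)
Fixpoint Phi (a : nat -> R) (m : nat) (x : R) : R :=
  match m with
  | O => x
  | S k => phi (a (S k)) (Phi a k x)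
  end.

Lemma cosh_gt_0 x : 0 < cosh x.
Proof.
unfold cosh. pose proof (exp_pos x). pose proof (exp_pos (- x)). lra.
Qed.

Lemma cosh_increasing_pos x y : 0 < x -> x < y -> cosh x < cosh y.
Proof.
intros Hx Hxy.
destruct (MVT_cor2 cosh sinh x y Hxy) as [c [E Hc]].
{ intros; apply derivable_pt_lim_cosh. }
assert (0 < sinh c).
{ unfold sinh. assert (exp (- c) < exp c) by (apply exp_increasing; lra). lra. }
nra.
Qed.

Lemma phi_sub_derive a x :
  derivable_pt_lim (fun t => phi a t - t) x (a / cosh (a * x) ^ 2 - 1).
Proof.
pose proof (cosh_gt_0 (a * x)) as Hc.
apply is_derive_Reals. unfold phi, tanh, sinh. unfold cosh in *.
auto_derive.
- lra.
- assert (E : exp (a * x) * exp (- (a * x)) = 1)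
    by (rewrite <- exp_plus, Rplus_opp_r; apply exp_0).
  set (u := exp (a * x)) in *. set (v := exp (- (a * x))) in *.
  transitivity (a * (u * v) / ((u + v) / 2) ^ 2 - 1).
  + field. lra.
  + rewrite E. field. lra.
Qed.

Lemma xi_exists_unique a : 1 < a -> exists! x, is_xi a x.
Proof.
intros Ha. apply -> unique_existence. split.
- set (d := ln a / (2 * a)).
  assert (Hl : 0 < ln a) by (rewrite <- ln_1; apply ln_increasing; lra).
  assert (Hd : 0 < d) by (unfold d; apply Rdiv_lt_0_compat; lra).
  set (g := fun t => phi a t - t).
  assert (Hg0 : g 0 = 0).
  { unfold g, phi, tanh. rewrite Rmult_0_r, sinh_0, cosh_0. field. }
  assert (Hgd : 0 < g d).
  { destruct (MVT_cor2 g (fun x => a / cosh (a * x) ^ 2 - 1) 0 d Hd)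
      as [c [E Hc]].
    { intros; apply phi_sub_derive. }
    assert (Hcc : cosh (a * c) ^ 2 < a).
    { assert (H1 : cosh (a * c) < exp (a * c)).
      { unfold cosh.
        assert (exp (- (a * c)) < exp (a * c)) by (apply exp_increasing; nra).
        lra. }
      assert (H2 : exp (a * c) * exp (a * c) < a).
      { rewrite <- exp_plus. rewrite <- (exp_ln a) at 3 by lra.
        apply exp_increasing.
        replace (ln a) with (a * d + a * d) by (unfold d; field; lra). nra. }
      pose proof (cosh_gt_0 (a * c)). nra. }
    assert (0 < a / cosh (a * c) ^ 2 - 1).
    { pose proof (cosh_gt_0 (a * c)).
      assert (0 < cosh (a * c) ^ 2) by (apply pow_lt; assumption).
      apply Rlt_0_minus, (Rmult_lt_reg_r (cosh (a * c) ^ 2)); [assumption|].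
      unfold Rdiv. rewrite Rmult_assoc, Rinv_l; lra. }
    nra. }
  assert (Hg1 : g 1 < 0).
  { unfold g, phi, tanh. rewrite Rmult_1_r. pose proof (cosh_gt_0 a).
    apply Rlt_minus, (Rmult_lt_reg_r (cosh a)); [assumption|].
    unfold Rdiv. rewrite Rmult_assoc, Rinv_l by lra.
    unfold sinh, cosh. pose proof (exp_pos (- a)). lra. }
  destruct (IVT_gen g d 1 0) as [x [[Hx _] Ex]].
  + intros x. apply derivable_continuous_pt.
    eexists. apply phi_sub_derive.
  + rewrite Rmin_right, Rmax_left; lra.
  + exists x. split.
    * apply Rlt_le_trans with (Rmin d 1); [apply Rmin_glb_lt; lra | exact Hx].
    * unfold g in Ex. lra.
- assert (W : forall x y, is_xi a x -> is_xi a y -> ~ x < y).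
  { intros x y [Hx Ex] [Hy Ey] Hxy.
    assert (E0 : phi a 0 = 0).
    { unfold phi, tanh. rewrite Rmult_0_r, sinh_0, cosh_0. field. }
    destruct (MVT_cor2 (fun t => phi a t - t)
                (fun t => a / cosh (a * t) ^ 2 - 1) 0 x Hx) as [c [E Hc]].
    { intros; apply phi_sub_derive. }
    destruct (MVT_cor2 (fun t => phi a t - t)
                (fun t => a / cosh (a * t) ^ 2 - 1) x y Hxy) as [e [F He]].
    { intros; apply phi_sub_derive. }
    simpl in E, F. rewrite Ex, E0 in E. rewrite Ex, Ey in F.
    assert (H1 : cosh (a * c) < cosh (a * e)).
    { apply cosh_increasing_pos; nra. }
    pose proof (cosh_gt_0 (a * c)). pose proof (cosh_gt_0 (a * e)).
    assert (A : forall z, 0 < cosh z -> a / (cosh z * (cosh z * 1)) - 1 = 0 ->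
                a = cosh z * cosh z).
    { intros z Hz Q. apply (f_equal (fun t => (t + 1) * (cosh z * cosh z))) in Q.
      field_simplify in Q; lra. }
    assert (a = cosh (a * c) * cosh (a * c)) by (apply A; nra).
    assert (a = cosh (a * e) * cosh (a * e)) by (apply A; nra).
    nra. }
  intros x y Hx Hy.
  destruct (Rtotal_order x y) as [H | [H | H]]; [| exact H |]; exfalso.
  + exact (W x y Hx Hy H).
  + exact (W y x Hy Hx H).
Qed.

Lemma xi_spec a : 1 < a -> is_xi a (xi a).
Proof.
intros Ha. unfold xi. apply epsilon_spec.
destruct (xi_exists_unique a Ha) as [x [Hx _]]. now exists x.
Qed.

(* Main.v *)
(** From some index on, [|Phi_m(x)|] satisfies [y' >= tanh (c y)] with
    [c = 1 + eps], so it dominates the orbit of the single map [phi_c] started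
    at [min y xi_c].  Concavity of [tanh] makes that orbit nondecreasing and
    bounded by [xi_c]; its limit is a positive fixed point of [phi_c], hence
    is [xi_c]. *)

Require Import Defs.
From Stdlib Require Import Reals Finite_sets Lra Lia.
From Coquelicot Require Import Coquelicot.
Open Scope R_scope.

Lemma Finite_nat_bounded (P : Ensembles.Ensemble nat) :
  Finite_sets.Finite nat P -> exists N, forall n, P n -> (n < N)%nat.
Proof.
intros HP. induction HP as [|A HA [N HN] y Hy].
- exists 0%nat. intros n [].
- exists (N + S y)%nat. intros n [m Hm | m Hm].
  + specialize (HN m Hm). lia.
  + destruct Hm. lia.
Qed.

Lemma tanh_le x y : x <= y -> tanh x <= tanh y.
Proof.
intros Hxy.
assert (H1 : exp x <= exp y) by (destruct Hxy as [H | ->];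
  [left; now apply exp_increasing | lra]).
assert (H2 : exp (- y) <= exp (- x)) by (destruct Hxy as [H | ->];
  [left; apply exp_increasing; lra | lra]).
pose proof (cosh_gt_0 x) as Hx. pose proof (cosh_gt_0 y) as Hy.
unfold tanh. apply (Rmult_le_reg_r (cosh x * cosh y)); [nra |].
replace (sinh x / cosh x * (cosh x * cosh y)) with (sinh x * cosh y)
  by (field; lra).
replace (sinh y / cosh y * (cosh x * cosh y)) with (sinh y * cosh x)
  by (field; lra).
(* Once expanded, the inequality reduces to [exp x * exp (- y) <= exp y * exp (- x)]. *)
unfold sinh, cosh.
pose proof (exp_pos x). pose proof (exp_pos (- y)). nra.
Qed.

Lemma tanh_gt_0 x : 0 < x -> 0 < tanh x.
Proof.
intros Hx. unfold tanh. apply Rdiv_lt_0_compat; [| apply cosh_gt_0].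
unfold sinh. assert (exp (- x) < exp x) by (apply exp_increasing; lra). lra.
Qed.

Lemma tanh_opp x : tanh (- x) = - tanh x.
Proof.
pose proof (cosh_gt_0 x) as Hx. unfold tanh, sinh, cosh in *.
rewrite Ropp_involutive. field. lra.
Qed.

Lemma phi_0 a : phi a 0 = 0.
Proof. unfold phi, tanh. rewrite Rmult_0_r, sinh_0. apply Rdiv_0_l. Qed.

Lemma phi_le a b x y : 0 <= a <= b -> 0 <= x <= y -> phi a x <= phi b y.
Proof. intros. apply tanh_le. apply Rmult_le_compat; lra. Qed.

(** Since [tanh] is odd, absolute values pass through each map, so the absolute orbit stays in the
    region where [phi_le] applies. *)
Lemma Rabs_phi a x : 0 < a -> Rabs (phi a x) = phi a (Rabs x).
Proof.
intros Ha. unfold phi.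
destruct (Rtotal_order x 0) as [H | [-> | H]].
- rewrite (Rabs_left x) by lra.
  rewrite Rabs_left; [rewrite <- tanh_opp; f_equal; ring |].
  replace (a * x) with (- (a * - x)) by ring. rewrite tanh_opp.
  assert (0 < tanh (a * - x)) by (apply tanh_gt_0; nra). lra.
- rewrite Rabs_R0. fold (phi a 0). rewrite phi_0. apply Rabs_R0.
- rewrite (Rabs_right x) by lra. apply Rabs_right.
  left. apply tanh_gt_0. nra.
Qed.

Lemma continuity_phi a : continuity (phi a).
Proof.
intros x.
(* Splitting off the identity lets [phi_sub_derive] give the continuity. *)
apply (continuity_pt_ext (fun t => (phi a t - t) + t)); [intros; ring |].
apply continuity_pt_plus; [| apply derivable_continuous_pt, derivable_pt_id].
apply derivable_continuous_pt. eexists. apply phi_sub_derive.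
Qed.

(* If [phi a z < z], the mean value theorem yields slopes of [phi a t - t]
   that are negative before [z] and positive after it, although its derivative
   [a / cosh (a t) ^ 2 - 1] decreases. *)
Lemma le_phi_below_fixpoint a x z :
  0 < a -> is_xi a x -> 0 < z <= x -> z <= phi a z.
Proof.
intros Ha [Hx Ex] [Hz [Hzx | ->]]; [| lra].
apply Rnot_lt_le. intros Hlt.
destruct (MVT_cor2 (fun t => phi a t - t)
            (fun t => a / cosh (a * t) ^ 2 - 1) 0 z Hz) as [c [E Hc]].
{ intros; apply phi_sub_derive. }
destruct (MVT_cor2 (fun t => phi a t - t)
            (fun t => a / cosh (a * t) ^ 2 - 1) z x Hzx) as [d [F Hd]].
{ intros; apply phi_sub_derive. }
cbv beta in E, F. rewrite phi_0 in E. rewrite Ex in F.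
assert (H : a / cosh (a * d) ^ 2 < a / cosh (a * c) ^ 2).
{ pose proof (cosh_gt_0 (a * c)) as H0.
  assert (H1 : cosh (a * c) < cosh (a * d)).
  { apply cosh_increasing_pos; nra. }
  apply Rmult_lt_compat_l; [lra |].
  apply Rinv_lt_contravar; [| nra].
  apply Rmult_lt_0_compat; apply pow_lt; lra. }
assert (a / cosh (a * c) ^ 2 < 1) by (apply Rnot_le_lt; nra).
assert (1 < a / cosh (a * d) ^ 2) by (apply Rnot_le_lt; nra).
lra.
Qed.

(** Both bounds are carried together: they keep each iterate in the interval from 0 (excluded) to
    [xi c], on which [phi c] does not decrease its argument. *)
Lemma Phi_const_bounds c z k : 1 < c -> 0 < z <= xi c ->
  z <= Phi (fun _ => c) k z <= xi c.
Proof.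
intros Hc Hz. pose proof (xi_spec c Hc) as Hxi.
induction k as [|k IH]; simpl; [lra |]. split.
- apply Rle_trans with (Phi (fun _ => c) k z); [lra |].
  apply le_phi_below_fixpoint with (xi c); [lra | easy | lra].
- rewrite <- (proj2 Hxi). apply phi_le; lra.
Qed.

Lemma is_lim_seq_Phi_const c z : 1 < c -> 0 < z <= xi c ->
  is_lim_seq (fun k => Phi (fun _ => c) k z) (xi c).
Proof.
intros Hc Hz. pose proof (xi_spec c Hc) as Hxi.
set (u := fun k => Phi (fun _ => c) k z).
assert (B : forall k, z <= u k <= xi c) by (intros; now apply Phi_const_bounds).
destruct (ex_finite_lim_seq_incr u (xi c)) as [l Hl].
- intros k. change (u k <= phi c (u k)).
  specialize (B k).
  apply le_phi_below_fixpoint with (xi c); [lra | easy | lra].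
- intros k. apply B.
(* This excludes the fixed point 0 as the limit. *)
- assert (Hzl : z <= l).
  { apply (is_lim_seq_le (fun _ => z) u z l);
      [intros; apply B | apply is_lim_seq_const | exact Hl]. }
  assert (Hfix : phi c l = l).
  { assert (H1 : is_lim_seq (fun k => u (S k)) (phi c l)).
    { apply (is_lim_seq_continuous (phi c) u l);
        [apply continuity_phi | exact Hl]. }
    apply (is_lim_seq_incr_1 u) in H1.
    apply is_lim_seq_unique in H1. apply is_lim_seq_unique in Hl.
    rewrite Hl in H1. now injection H1. }
  destruct (xi_exists_unique c Hc) as [w [_ Hw]].
  replace (xi c) with l; [exact Hl |].
  rewrite <- (Hw (xi c) Hxi). symmetry. apply Hw. split; lra.
Qed.

(** The initial segment, where parameters may be small, can shrink the orbit but never bring it to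
    0; this leaves a positive starting value for the comparison. *)
Lemma Rabs_Phi_gt_0 a x n : (forall n, (1 <= n)%nat -> 0 < a n) -> x <> 0 ->
  0 < Rabs (Phi a n x).
Proof.
intros Ha Hx. induction n as [|n IH]; simpl.
- now apply Rabs_pos_lt.
- assert (0 < a (S n)) by (apply Ha; lia).
  rewrite Rabs_phi by easy. apply tanh_gt_0. nra.
Qed.

(** Induction on [k], using that [phi] is monotone in both its parameter and its argument on
    nonnegative reals. *)
Lemma Phi_const_le_Rabs_Phi a c x z N : 1 < c ->
  (forall n, (N < n)%nat -> c <= a n) ->
  0 < z <= xi c -> z <= Rabs (Phi a N x) ->
  forall k, Phi (fun _ => c) k z <= Rabs (Phi a (k + N) x).
Proof.
intros Hc Ha Hz HN k. induction k as [|k IH]; simpl; [easy |].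
assert (c <= a (S (k + N))) by (apply Ha; lia).
rewrite Rabs_phi by lra.
pose proof (Phi_const_bounds c z k Hc Hz).
apply phi_le; lra.
Qed.

(** The absolute orbit may oscillate, for instance when [a] alternates between two values above
    [1 + eps]. The bound is therefore on the lower limit, which equals the limit whenever that
    exists. *)
Theorem corollary4 (eps : R) (heps : 0 < eps)
  (a : nat -> R) (hpos : forall n : nat, (1 <= n)%nat -> 0 < a n)
  (hfin : Finite_sets.Finite nat
            (fun n : nat => (1 <= n)%nat /\ a n < 1 + eps))
  (x : R) (hx : x <> 0) :
  Rbar_le (Rbar.Finite (xi (1 + eps)))
          (LimInf_seq (fun m : nat => Rabs (Phi a m x))).
Proof.
destruct (Finite_nat_bounded _ hfin) as [N HN].
set (c := 1 + eps) in *. assert (Hc : 1 < c) by (unfold c; lra).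
assert (Ha : forall n, (N < n)%nat -> c <= a n).
{ intros n Hn. apply Rnot_lt_le. intros H.
  assert (n < N)%nat by (apply HN; split; [lia | easy]). lia. }
pose proof (Rabs_Phi_gt_0 a x N hpos hx) as Hy.
destruct (xi_spec c Hc) as [Hxi _].
(* Capping at [xi c] puts the start where the constant-parameter orbit is nondecreasing. *)
set (z := Rmin (Rabs (Phi a N x)) (xi c)).
assert (Hz : 0 < z <= xi c).
{ split; [now apply Rmin_glb_lt | apply Rmin_r]. }
(* The comparison orbit is delayed by [N]; truncated subtraction makes [v] equal to [z] up to index
   [N], which does not affect its limit. *)
set (v := fun m => Phi (fun _ => c) (m - N) z).
assert (Hv : is_lim_seq v (xi c)).
{ apply (is_lim_seq_incr_n v N).
  apply is_lim_seq_ext with (fun k => Phi (fun _ => c) k z).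
  - intros k. unfold v. do 2 f_equal. lia.
  - now apply is_lim_seq_Phi_const. }
rewrite <- (is_LimInf_seq_unique v (xi c)) by now apply is_lim_LimInf_seq.
apply LimInf_le. exists N. intros m Hm. unfold v.
replace m with ((m - N) + N)%nat at 2 by lia.
apply Phi_const_le_Rabs_Phi; [easy | easy | easy | apply Rmin_l].
Qed.
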